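(* Let $N\ge 2$, let $f_1,\dots,f_N:\mathbb{R}^n\to\mathbb{R}$ be convex, $F=\sum_{i=1}^N f_i$, and let the Selective Linearization (SLIN) algorithm be run with $\varepsilon=0$, generating proximal centers $x^k$. Suppose $\operatorname{Argmin}F\neq\emptyset$. If the set $\mathcal{K}=\{k: x^{k+1}\ne x^k\}$ is infinite, then $\lim_{k\to\infty}x^k=x^*$ for some $x^*\in\operatorname{Argmin}F$.
   Context: Notation: $D$ is a fixed symmetric positive definite $n\times n$ matrix, $\|x\|_D=\langle x,Dx\rangle^{1/2}$. SLIN algorithm (stopping precision $\varepsilon$, parameter $\beta\in(0,1)$), for minimizing $F=\sum_{i=1}^N f_i$: Step 0. Set $k=1$, choose $j_1\in\{1,\dots,N\}$, $x^1\in\mathbb{R}^n$, and for all $i\ne j_1$ points $z_i^1\in\mathbb{R}^n$ and subgradients $g_i^1\in\partial f_i(z_i^1)$. At every iteration, put $\tilde f_i^k(x)=f_i(z_i^k)+\langle g_i^k,x-z_i^k\rangle$ and $\tilde F^k(x)=f_{j_k}(x)+\sum_{i\neq j_k}\tilde f_i^k(x)$. Step 1. Let $z^k_{j_k}$ be the (unique) solution of $\min_x \tilde F^k(x)+\frac12\|x-x^k\|_D^2$, and set $g^k_{j_k}=-\sum_{i\ne j_k}g_i^k-D(z^k_{j_k}-x^k)$ (this is a subgradient of $f_{j_k}$ at $z^k_{j_k}$). Step 2. If $F(x^k)-\tilde F^k(z^k_{j_k})\le\varepsilon$, stop. Otherwise continue. Step 3. If $F(z^k_{j_k})\le F(x^k)-\beta\big(F(x^k)-\tilde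 F^k(z^k_{j_k})\big)$, set $x^{k+1}=z^k_{j_k}$ (descent step); otherwise set $x^{k+1}=x^k$ (null step). Step 4. Select $j_{k+1}\in\arg\max_{i\ne j_k}\{f_i(z^k_{j_k})-\tilde f_i^k(z^k_{j_k})\}$. For all $i\ne j_{k+1}$ set $z_i^{k+1}=z_i^k$, $g_i^{k+1}=g_i^k$ (so $\tilde f_i^{k+1}\equiv\tilde f_i^k$; for $i=j_k$ this uses $z^k_{j_k},g^k_{j_k}$ from Step 1). Increase $k$ by 1 and go to Step 1. *)

(* Defs.v *)
From HB Require Import structures.
From mathcomp Require Import all_boot all_order all_algebra.
From mathcomp Require Import all_classical all_reals all_analysis.

Set Implicit Arguments.
Unset Strict Implicit.
Unset Printing Implicit Defensive.

Import Order.TTheory GRing.Theory Num.Theory.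
Import numFieldNormedType.Exports.

Local Open Scope classical_set_scope.
Local Open Scope ring_scope.

Definition dot (R : realType) (n : nat) (u v : 'cV[R]_n) : R :=
  \sum_(l < n) u l 0 * v l 0.

Definition sym_posdef (R : realType) (n : nat) (D : 'M[R]_n) : Prop :=
  D^T = D /\ forall u : 'cV[R]_n, u != 0 -> 0 < dot u (D *m u).

Definition normD (R : realType) (n : nat) (D : 'M[R]_n) (u : 'cV[R]_n) : R :=
  Num.sqrt (dot u (D *m u)).

Definition convex_fun (R : realType) (n : nat) (h : 'cV[R]_n -> R) : Prop :=
  convex_function (setT : set (convex_lmodType 'cV[R]_n)) h.

Definition subdifferential (R : realType) (n : nat) (h : 'cV[R]_n -> R)
    (z : 'cV[R]_n) : set 'cV[R]_n :=
  [set g | forall y, h z + dot g (y - z) <= h y].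

Definition Argmin (R : realType) (n : nat) (h : 'cV[R]_n -> R) :
    set 'cV[R]_n :=
  [set u | forall y, h u <= h y].

Section Slin.
Context (R : realType) (n N : nat).
Local Notation V := 'cV[R]_n.
Variable f : 'I_N -> V -> R.

Definition Ftot (y : V) : R := \sum_(i < N) f i y.

Definition flin (z g : 'I_N -> V) (i : 'I_N) (y : V) : R :=
  f i (z i) + dot (g i) (y - z i).

Definition Fmodel (j : 'I_N) (z g : 'I_N -> V) (y : V) : R :=
  f j y + \sum_(i < N | i != j) flin z g i y.

(* The k-th terms x k, j k, z k, g k are the data of iteration k + 1, as
   iterations are numbered from 1.  The entries z k (j k) and g k (j k) are
   those computed in Step 1 of the iteration. *)
Section Iterates.
Variables (x : nat -> V) (j : nat -> 'I_N) (z g : nat -> 'I_N -> V).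

Definition trial (k : nat) : V := z k (j k).

(* the gap F(x^k) - \tilde F^k(z^k_{j_k}) tested in Steps 2 and 3 *)
Definition model_gap (k : nat) : R :=
  Ftot (x k) - Fmodel (j k) (z k) (g k) (trial k).

(* the error f_i(z^k_{j_k}) - \tilde f_i^k(z^k_{j_k}) maximized in Step 4 *)
Definition lin_error (k : nat) (i : 'I_N) : R :=
  f i (trial k) - flin (z k) (g k) i (trial k).

(* A run that stops in Step 2 is represented by a sequence that is constant
   from the stopping iteration on. *)
Record slin_run (D : 'M[R]_n) (eps beta : R) : Prop := SlinRun {
  slin_init : forall i, i != j 0%N -> subdifferential (f i) (z 0%N i) (g 0%N i);
  slin_trial : forall k,
    Argmin (fun y => Fmodel (j k) (z k) (g k) y
                     + 2^-1 * normD D (y - x k) ^+ 2) (trial k);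
  slin_subgrad : forall k,
    g k (j k) = - (\sum_(i < N | i != j k) g k i) - D *m (trial k - x k);
  slin_stop : forall k, model_gap k <= eps ->
    [/\ x k.+1 = x k, j k.+1 = j k, z k.+1 = z k & g k.+1 = g k];
  slin_center : forall k, eps < model_gap k ->
    x k.+1 = if Ftot (trial k) <= Ftot (x k) - beta * model_gap k
             then trial k else x k;
  slin_select : forall k, eps < model_gap k ->
    j k.+1 != j k /\
    forall i, i != j k -> lin_error k i <= lin_error k (j k.+1);
  slin_keep : forall k, eps < model_gap k ->
    forall i, i != j k.+1 -> z k.+1 i = z k i /\ g k.+1 i = g k i
}.

End Iterates.
End Slin.

(* Main.v *)
Require Import Defs.
From HB Require Import structures.
From mathcomp Require Import all_boot all_order all_algebra.
From mathcomp Require Import all_classical all_reals all_analysis.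
From mathcomp Require Import ring lra.

(** Every [g k i] is a subgradient of [f i] at [z k i], so the model lies below
    [F], and the optimality of the trial point in the proximal subproblem gives
      [|z - p|_D^2 <= |x k - p|_D^2 + 2 gap - 2 (F (x k) - F p)]
    for every [p].  At a descent step [gap <= (F (x k) - F (x k.+1)) / beta],
    so [|x k - p|_D^2 + (2 / beta) (F (x k) - F p)] drops by at least
    [2 (F (x k) - F p)] at each descent step and is constant at null steps.
    For a minimizer [p] this quantity is nonnegative; as there are infinitely
    many descent steps, [F (x k)] tends to [min F] and [x] is bounded.  A
    cluster point of [x] is a minimizer by lower semicontinuity, and taking it
    as [p] makes the quantity tend to [0]. *)

Set Implicit Arguments.
Unset Strict Implicit.
Unset Printing Implicit Defensive.

Import Order.TTheory GRing.Theory Num.Theory.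
Import numFieldNormedType.Exports.

Local Open Scope classical_set_scope.
Local Open Scope ring_scope.

(** * Geometry of a positive definite quadratic form *)

Section InnerProduct.
Context (R : realType) (n : nat).
Implicit Types (u v w : 'cV[R]_n) (D : 'M[R]_n).

Lemma dotE u v : dot u v = (u^T *m v) 0 0.
Proof. by rewrite mxE; apply: eq_bigr => l _; rewrite mxE. Qed.

Lemma dotC u v : dot u v = dot v u.
Proof. by apply: eq_bigr => l _; rewrite mulrC. Qed.

Lemma dotDl u v w : dot (u + v) w = dot u w + dot v w.
Proof. by rewrite !dotE linearD mulmxDl mxE. Qed.

Lemma dotNl u w : dot (- u) w = - dot u w.
Proof. by rewrite !dotE linearN mulNmx mxE. Qed.

Lemma dotZl a u w : dot (a *: u) w = a * dot u w.
Proof. by rewrite !dotE linearZ -scalemxAl mxE. Qed.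

Lemma dotDr u v w : dot w (u + v) = dot w u + dot w v.
Proof. by rewrite dotC dotDl !(dotC w). Qed.

Lemma dotNr u w : dot w (- u) = - dot w u.
Proof. by rewrite dotC dotNl (dotC w). Qed.

Lemma dotZr a u w : dot w (a *: u) = a * dot w u.
Proof. by rewrite dotC dotZl (dotC w). Qed.

Lemma dot_suml (I : finType) (P : pred I) (g : I -> 'cV[R]_n) w :
  dot (\sum_(i | P i) g i) w = \sum_(i | P i) dot (g i) w.
Proof.
elim/big_rec2: _ => [|i a b _ <-]; last by rewrite dotDl.
by rewrite /dot big1 // => l _; rewrite mxE mul0r.
Qed.

Lemma dot_symmx D u v : D^T = D -> dot u (D *m v) = dot v (D *m u).
Proof. by move=> DT; rewrite dotC !dotE trmx_mul DT mulmxA. Qed.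

Lemma posdef_ge0 D u : sym_posdef D -> 0 <= dot u (D *m u).
Proof.
move=> [_ Dpos]; have [->|u0] := eqVneq u 0; last exact/ltW/Dpos.
by rewrite mulmx0 /dot big1 // => l _; rewrite mxE mul0r.
Qed.

Lemma normD_sqr D u : sym_posdef D -> normD D u ^+ 2 = dot u (D *m u).
Proof. by move=> hD; rewrite sqr_sqrtr // posdef_ge0. Qed.

Lemma posdef_sqD D u v : sym_posdef D ->
  dot (u + v) (D *m (u + v)) =
  dot u (D *m u) + 2 * dot v (D *m u) + dot v (D *m v).
Proof.
move=> [DT _]; rewrite mulmxDr dotDl !dotDr (dot_symmx u v DT); ring.
Qed.

Lemma posdef_cauchy_schwarz D u v : sym_posdef D ->
  dot u (D *m v) ^+ 2 <= dot u (D *m u) * dot v (D *m v).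
Proof.
move=> hD; have [->|v0] := eqVneq v 0.
  by rewrite mulmx0 -[0](scale0r (0 : 'cV[R]_n)) dotZr dotZl !mul0r mulr0 expr0n.
have c_gt0 := hD.2 v v0; set b := dot u _; set a := dot u _; set c := dot v _.
(* The form at [c u - b v] expands to [c * (a * c - b ^+ 2)], with [c] positive. *)
have := posdef_ge0 (c *: u + (- b) *: v) hD.
rewrite posdef_sqD // -!scalemxAr !(dotZl, dotZr) (dot_symmx v u hD.1) -/a -/b -/c.
rewrite (_ : _ + _ = c * (a * c - b ^+ 2)); last by ring.
by rewrite pmulr_rge0 // subr_ge0.
Qed.

Lemma posdef_unitmx D : sym_posdef D -> D \in unitmx.
Proof.
move=> [DT Dpos]; rewrite unitmxE unitfE; apply/det0P => -[v v0 vD].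
have vT0 : v^T != 0 by rewrite trmx_eq0.
by have := Dpos _ vT0; rewrite dotE trmxK mulmxA vD mul0mx mxE ltxx.
Qed.

(* Cauchy-Schwarz applied to [u l = <D^-1 e_l, u>_D]. *)
Lemma posdef_coord_bound D : sym_posdef D ->
  exists2 C : R, 0 <= C & forall u l, u l 0 ^+ 2 <= C * dot u (D *m u).
Proof.
move=> hD; pose q l : 'cV[R]_n := invmx D *m delta_mx l 0.
exists (\sum_l dot (q l) (D *m q l)).
  by apply: sumr_ge0 => l _; exact: posdef_ge0.
move=> u l; have -> : u l 0 = dot u (D *m q l).
  rewrite mulmxA mulmxV ?posdef_unitmx // mul1mx dotC.
  by rewrite dotE trmx_delta -rowE mxE.
apply: le_trans (posdef_cauchy_schwarz _ _ hD) _; rewrite mulrC.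
apply: ler_wpM2r; first exact: posdef_ge0.
rewrite (bigD1 l) //= lerDl.
by apply: sumr_ge0 => i _; exact: posdef_ge0.
Qed.

(** Converse to the coordinate bound above: coordinatewise closeness gives closeness in [normD]. *)
Lemma quadratic_coord_bound D :
  exists2 C : R, 0 <= C & forall u (e : R), 0 <= e ->
    (forall l, `|u l 0| <= e) -> dot u (D *m u) <= C * e ^+ 2.
Proof.
exists (\sum_l \sum_m `|D l m|).
  by apply: sumr_ge0 => l _; exact: sumr_ge0.
move=> u e e0 ue; rewrite mulr_suml; apply: ler_sum => l _.
rewrite mxE mulr_sumr mulr_suml; apply: ler_sum => m _.
apply: le_trans (ler_norm _) _; rewrite !normrM mulrCA expr2.
by rewrite ler_wpM2l // ler_pM.
Qed.

End InnerProduct.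

(** * Convexity: Jensen's inequality and lower semicontinuity *)

Section Convex.
Context (R : realType) (n : nat).
Implicit Types (u v w : 'cV[R]_n) (h : 'cV[R]_n -> R).

Lemma convex_funP h u v t : convex_fun h -> 0 <= t -> t <= 1 ->
  h (t *: u + (1 - t) *: v) <= t * h u + (1 - t) * h v.
Proof. by move=> hh t0 t1; apply: (hh (Itv01 t0 t1)); rewrite inE. Qed.

(** Subadditivity of the perspective [a * h (u / a)]; it is the induction step of Jensen's
    inequality with unnormalized weights. *)
Lemma convex_fun_persp h u v a b : convex_fun h -> 0 < a -> 0 <= b ->
  (a + b) * h ((a + b)^-1 *: (u + b *: v)) <= a * h (a^-1 *: u) + b * h v.
Proof.
move=> hh a0 b0; have ab0 : 0 < a + b by lra.
have ab1 : 1 - a / (a + b) = b / (a + b) by field; rewrite gt_eqF.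
have := @convex_funP h (a^-1 *: u) v (a / (a + b)) hh.
rewrite ab1 scalerA mulrAC divff ?gt_eqF // mul1r.
rewrite (_ : _ + _ *: v = (a + b)^-1 *: (u + b *: v)); last first.
  by rewrite scalerDr scalerA mulrC [_^-1 * b]mulrC.
have t0 : 0 <= a / (a + b) by rewrite divr_ge0 // ltW.
have t1 : a / (a + b) <= 1 by rewrite ler_pdivrMr // mul1r lerDl.
move=> /(_ t0 t1); rewrite -(ler_pM2l ab0) => /le_trans; apply.
by rewrite le_eqVlt; apply/orP; left; apply/eqP; field; rewrite gt_eqF.
Qed.

(** The weight 1 on [v] keeps the total weight positive even if every [b i] vanishes, so the
    normalization never divides by zero. *)
Lemma convex_fun_jensen (I : Type) (r : seq I) (b : I -> R)
    (q : I -> 'cV[R]_n) h v : convex_fun h -> (forall i, 0 <= b i) ->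
  (1 + \sum_(i <- r) b i) *
    h ((1 + \sum_(i <- r) b i)^-1 *: (v + \sum_(i <- r) b i *: q i)) <=
  h v + \sum_(i <- r) b i * h (q i).
Proof.
move=> hh b0; elim: r => [|i r IH].
  by rewrite !big_nil !addr0 invr1 scale1r mul1r.
rewrite !big_cons [b i + _]addrC [b i *: _ + _]addrC !addrA.
rewrite [h v + _ + _]addrAC.
apply: le_trans (convex_fun_persp _ _ hh _ (b0 i)) _; last by rewrite lerD2r.
by rewrite ltr_pwDl // sumr_ge0.
Qed.

(* [u] is the barycenter of [v], with weight 1, and of the points
   [u + sg (u - v)_l e_l], with weights [|(u - v)_l|]. *)
Lemma convex_fun_lower_bound h u : convex_fun h ->
  exists2 C : R, 0 <= C & forall v (e : R), 0 <= e ->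
    (forall l, `|(u - v) l 0| <= e) -> h u <= h v + C * e.
Proof.
move=> hh; pose p s l : 'cV[R]_n := u + s *: delta_mx l 0.
(* Dominates [h (p s l) - h u] for each of the values 1, -1, 0 of the sign [s]. *)
pose M l := `|h (p 1 l)| + `|h (p (-1) l)| + `|h (p 0 l)| + `|h u|.
exists (\sum_l M l).
  by apply: sumr_ge0 => l _; rewrite !addr_ge0.
move=> v e e0 uve; pose d l := (u - v) l 0; pose b l := `|d l|.
pose q l := p (Num.sg (d l)) l.
have := convex_fun_jensen (index_enum 'I_n) q v hh (fun l => normr_ge0 (d l)).
rewrite -/b (_ : v + _ = (1 + \sum_l b l) *: u); last first.
  have -> : \sum_l b l *: q l = (\sum_l b l) *: u + (u - v).
    rewrite [X in _ = _ + X](matrix_sum_delta (u - v)) scaler_suml.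
    under [X in _ = _ + X]eq_bigr do rewrite big_ord1.
    rewrite -big_split /=; apply: eq_bigr => l _.
    rewrite scalerDr scalerA mulrC -numEsg.
    by congr (_ + _).
  by rewrite scalerDl scale1r addrCA subrKC addrC.
have s0 : 0 < 1 + \sum_l b l by rewrite ltr_pwDl // /b sumr_ge0.
rewrite scalerA mulVf ?gt_eqF // scale1r mulrDl mul1r mulr_suml.
rewrite -lerBrDr -addrA -sumrB => /le_trans; apply.
rewrite lerD2l mulr_suml; apply: ler_sum => l _.
rewrite -mulrBr mulrC; have Ml : h (q l) - h u <= M l.
  rewrite /q /M; have := ler_norm (- h u); rewrite normrN => ?.
  have := ler_norm (h (p 1 l)); have := ler_norm (h (p (-1) l)).
  have := ler_norm (h (p 0 l)); have := normr_ge0 (h (p 0 l)).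
  have := normr_ge0 (h (p 1 l)); have := normr_ge0 (h (p (-1) l)).
  by case: sgrP => _; lra.
apply: le_trans (ler_wpM2r (normr_ge0 _) Ml) _.
by apply: ler_wpM2l; [rewrite !addr_ge0|exact: uve].
Qed.


End Convex.

(** * Perturbation, cluster points and proximal optimality *)

Lemma ge0_of_linear_perturbation (R : realType) (a q : R) : 0 <= q ->
  (forall t, 0 < t -> t <= 1 -> 0 <= a + t * q) -> 0 <= a.
Proof.
move=> q0 aq; rewrite leNgt; apply/negP => a0.
have qa : 0 < 2 * (q - a) by lra.
(* At this [t], [a + t * q] equals [a * (q - 2 * a) / (2 * (q - a))], which is negative when
   [a < 0]. *)
have t0 : 0 < - a / (2 * (q - a)) by rewrite divr_gt0 // oppr_gt0.
have t1 : - a / (2 * (q - a)) <= 1 by rewrite ler_pdivrMr // mul1r; lra.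
have := aq _ t0 t1; rewrite -(pmulr_rge0 _ qa) => /(le_trans _)-/(_ 0).
have -> : 2 * (q - a) * (a + - a / (2 * (q - a)) * q) = a * (q - 2 * a).
  by field; rewrite gt_eqF //; lra.
have := @nmulr_rge0 R a (q - 2 * a) a0.
by move=> ->; lra.
Qed.

Lemma bounded_seq_cluster (R : realType) (n : nat) (y : nat -> 'cV[R]_n) (M : R) :
  (forall k l, `|y k l 0| <= M) ->
  exists u, forall (e : R) k0, 0 < e ->
    exists2 k, (k0 <= k)%N & forall l, `|(u - y k) l 0| < e.
Proof.
move=> yM.
(* The compact box consists of row vectors, hence the transposes. *)
have [//|a [_ acl]] := @rV_compact R n (fun=> `[- M, M]%classic)
  (fun=> @segment_compact _ _ _) ((fun k => (y k)^T) @ \oo) _.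
  by exists 0%N => // k _ l; rewrite /= in_itv /= mxE -ler_norml.
exists a^T => e k0 e0.
have [|v []] := acl [set (y k)^T | k in [set k | (k0 <= k)%N]] (ball a e) _
  (nbhsx_ballx _ _ e0).
  by exists k0 => // k /= k0k; exists k.
move=> [k k0k <-] [_ ay]; exists k => // l.
by have := ay 0 l; rewrite /ball /= !mxE.
Qed.
(** Compare [z] with [z + t (y - z)]: convexity bounds [h] there, and the quadratic term exceeds its
    linearization only by order [t ^ 2]. Dividing by [t] and letting it tend to 0 leaves the
    subgradient inequality. *)
Lemma prox_subgradient (R : realType) (n : nat) (D : 'M[R]_n)
    (h ell : 'cV[R]_n -> R) (b x z : 'cV[R]_n) :
  sym_posdef D -> convex_fun h ->
  (forall y, ell y = ell z + dot b (y - z)) ->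
  Argmin (fun y => h y + ell y + 2^-1 * normD D (y - x) ^+ 2) z ->
  subdifferential h z (- b - D *m (z - x)).
Proof.
move=> hD hh ellE zmin y; rewrite -subr_ge0.
apply: (@ge0_of_linear_perturbation _ _ (2^-1 * dot (y - z) (D *m (y - z)))).
  by rewrite mulr_ge0 ?posdef_ge0.
move=> t t0 t1; have := zmin (t *: y + (1 - t) *: z).
rewrite /= !normD_sqr // (ellE (_ + _)).
have -> : t *: y + (1 - t) *: z - z = t *: (y - z).
  by rewrite scalerBl scale1r scalerBr addrA addrAC addrK.
have -> : t *: y + (1 - t) *: z - x = (z - x) + t *: (y - z).
  by rewrite scalerBl scale1r scalerBr; apply/colP => l; rewrite !mxE; ring.
rewrite (posdef_sqD (z - x) (t *: _)) // -scalemxAr !(dotZl, dotZr).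
have := convex_funP y z hh (ltW t0) t1.
have -> : dot (- b - D *m (z - x)) (y - z) =
    - dot b (y - z) - dot (y - z) (D *m (z - x)).
  by rewrite dotDl !dotNl [dot (D *m _) _]dotC.
set Q := dot _ (D *m (y - z)).
set P := dot _ (D *m (z - x)); set B := dot b _; set hp := h (_ + _).
move=> le1 le2; rewrite -(pmulr_rge0 _ t0); lra.
Qed.

Lemma convex_fun_Ftot (R : realType) (n N : nat) (f : 'I_N -> 'cV[R]_n -> R) :
  (forall i, convex_fun (f i)) -> convex_fun (Ftot f).
Proof.
move=> hf t u v uT vT; rewrite convRE /Ftot !mulr_sumr -big_split.
by apply: ler_sum => i _; exact: hf.
Qed.

(** * Estimates along a run of the algorithm *)

Section SlinAnalysis.
Context (R : realType) (n N : nat) (D : 'M[R]_n) (f : 'I_N -> 'cV[R]_n -> R).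
Context (beta : R) (x : nat -> 'cV[R]_n) (j : nat -> 'I_N).
Context (z g : nat -> 'I_N -> 'cV[R]_n).
Hypotheses (hD : sym_posdef D) (hf : forall i, convex_fun (f i)).
Hypotheses (hbeta0 : 0 < beta) (hrun : slin_run f x j z g D 0 beta).

Local Notation F := (Ftot f).
Local Notation gap := (model_gap f x j z g).
Local Notation model k := (Fmodel f (j k) (z k) (g k)).
Local Notation sqnorm u := (dot u (D *m u)).

Lemma slin_trial_subgradient k :
  subdifferential (f (j k)) (z k (j k)) (g k (j k)).
Proof.
rewrite (slin_subgrad hrun k).
apply: (prox_subgradient (ell := fun y => \sum_(i < N | i != j k)
  flin f (z k) (g k) i y) hD (hf _) _ (slin_trial hrun k)) => y.
rewrite dot_suml -big_split; apply: eq_bigr => i _ /=.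
by rewrite /flin /trial !(dotDr, dotNr); ring.
Qed.

(** Each entry is either the trial one, settled by proximal optimality, or carried over from the
    previous iteration; a stopped run carries over everything. *)
Lemma slin_subgradient k i : subdifferential (f i) (z k i) (g k i).
Proof.
elim: k i => [|k IH] i.
  have [->|ij] := eqVneq i (j 0%N); first exact: slin_trial_subgradient.
  exact: (slin_init hrun).
have [gap0|gap0] := leP (gap k) 0.
  by have [_ _ -> ->] := slin_stop hrun gap0.
have [->|ij] := eqVneq i (j k.+1); first exact: slin_trial_subgradient.
by have [-> ->] := slin_keep hrun gap0 ij.
Qed.

Lemma model_le_Ftot k y : model k y <= F y.
Proof.
rewrite /Fmodel /Ftot [leRHS](bigD1 (j k)) //= lerD2l.
by apply: ler_sum => i _; exact: slin_subgradient.
Qed.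

(** The vector [- D *m (trial - x k)] is the sum of all the [g k i], hence a subgradient of the
    model at the trial point. *)
Lemma model_trial_lower_bound k y :
  model k (trial j z k) - dot (D *m (trial j z k - x k)) (y - trial j z k)
    <= model k y.
Proof.
have -> : - dot (D *m (trial j z k - x k)) (y - trial j z k) =
    dot (g k (j k)) (y - trial j z k) +
    \sum_(i < N | i != j k) dot (g k i) (y - trial j z k).
  by rewrite (slin_subgrad hrun) -dot_suml -dotDl -dotNl; congr dot;
    rewrite addrAC addNr add0r.
rewrite addrACA /Fmodel; apply: lerD; first exact: slin_trial_subgradient.
rewrite -big_split; apply: ler_sum => i _ /=.
by rewrite /flin !(dotDr, dotNr); lra.
Qed.

(** Expand the square of [(t - p) + (x k - t)] and drop that of [x k - t]; the cross term is at
    least [model k t - F p], that is, [F (x k) - gap k - F p]. *)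
Lemma trial_dist k p :
  sqnorm (trial j z k - p) <=
  sqnorm (x k - p) + 2 * gap k - 2 * (F (x k) - F p).
Proof.
have := model_trial_lower_bound k p; have := model_le_Ftot k p.
set t := trial j z k; rewrite /model_gap -/t.
have -> : x k - p = (t - p) + (x k - t) by rewrite [RHS]addrC subrKA.
have -> : dot (D *m (t - x k)) (p - t) = dot (x k - t) (D *m (t - p)).
  rewrite dotC dot_symmx ?hD.1 // -(opprB (x k) t) dotNl -(opprB t p) mulmxN dotNr.
  by rewrite opprK.
rewrite (posdef_sqD (t - p)) //; have := posdef_ge0 (x k - t) hD.
lra.
Qed.

Lemma center_move k : x k.+1 <> x k ->
  [/\ 0 < gap k, x k.+1 = trial j z k & F (x k.+1) <= F (x k) - beta * gap k].
Proof.
have [gap0|gap0] := leP (gap k) 0; first by have [->] := slin_stop hrun gap0.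
by rewrite (slin_center hrun gap0); case: ifP.
Qed.

Lemma Ftot_center_noninc k : F (x k.+1) <= F (x k).
Proof.
have [->//|/eqP/center_move[gap0 _ /le_trans]] := eqVneq (x k.+1) (x k).
by apply; rewrite gerBl mulr_ge0 // ltW.
Qed.

(** The weight [2 / beta] lets the decrease of [F] at a descent step pay for the term [2 * gap k] in
    [trial_dist]. *)
Definition lyapunov p k : R :=
  sqnorm (x k - p) + 2 / beta * (F (x k) - F p).

Lemma lyapunov_descent p k : x k.+1 <> x k ->
  lyapunov p k.+1 <= lyapunov p k - 2 * (F (x k) - F p).
Proof.
move=> /center_move[gap0 xk Fdesc]; have := trial_dist k p.
rewrite -xk /lyapunov => dist.
have : gap k <= beta^-1 * (F (x k) - F (x k.+1)).
  by rewrite ler_pdivlMl //; lra.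
by rewrite -mulrA; lra.
Qed.

(** * Consequences of monotonicity relative to a minimizer *)

Section Minimizer.
Context (p : 'cV[R]_n) (hp : Argmin F p).

Lemma lyapunov_noninc : nonincreasing_seq (lyapunov p).
Proof.
apply/nonincreasing_seqP => k.
have [xk|/eqP xk] := eqVneq (x k.+1) (x k); first by rewrite /lyapunov xk.
apply: le_trans (lyapunov_descent p xk) _.
by rewrite gerBl mulr_ge0 // subr_ge0.
Qed.

Lemma sqnorm_le_lyapunov k : sqnorm (x k - p) <= lyapunov p k.
Proof. by rewrite lerDl mulr_ge0 ?subr_ge0 // divr_ge0 // ltW. Qed.

Lemma Ftot_center_cvg : infinite_set [set k | x k.+1 <> x k] ->
  forall e : R, 0 < e -> exists k0, forall k, (k0 <= k)%N -> F (x k) < F p + e.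
Proof.
move=> hK e e0; have Fninc : nonincreasing_seq (F \o x).
  by apply/nonincreasing_seqP => k; exact: Ftot_center_noninc.
suff [k0 Fk0] : exists k, F (x k) < F p + e.
  by exists k0 => k k0k; apply: le_lt_trans Fk0; exact: Fninc.
apply: contrapT => /forallNP noF.
have Fge k : e <= F (x k) - F p by rewrite lerBrDl leNgt; exact/negP.
have movek m : exists2 k, (m <= k)%N & x k.+1 <> x k.
  apply: contrapT => nomove; apply: hK.
  apply: (sub_finite_set _ (finite_II m)) => k /= xk.
  by rewrite ltnNge; apply/negP => mk; apply: nomove; exists k.
(* While [F (x k)] stays [e] above the minimum, each descent step costs at least [2 * e]; infinitely
   many would make a nonnegative quantity negative. *)
have drop m : exists k, lyapunov p k <= lyapunov p 0 - e *+ m.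
  elim: m => [|m [k IH]]; first by exists 0%N; rewrite mulr0n subr0.
  have [k' kk' xk'] := movek k; exists k'.+1.
  have := lyapunov_descent p xk'; have := lyapunov_noninc kk'.
  by have := Fge k'; rewrite mulrSr; lra.
have [k] := drop (Num.Def.archi_bound (lyapunov p 0 / e)).
have := le_trans (posdef_ge0 _ hD) (sqnorm_le_lyapunov k).
have lyap0 := le_trans (posdef_ge0 _ hD) (sqnorm_le_lyapunov 0).
have := archi_boundP (divr_ge0 lyap0 (ltW e0)).
by rewrite ltr_pdivrMr // -mulr_natl; lra.
Qed.

Lemma center_bounded : exists M : R, forall k l, `|x k l 0| <= M.
Proof.
have [C C0 hC] := posdef_coord_bound hD.
exists (1 + C * lyapunov p 0 + \sum_l `|p l 0|) => k l.
(* Uses [r <= 1 + r ^+ 2], a consequence of [0 <= (r - 1) ^+ 2], to avoid a square root. *)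
have : `|(x k - p) l 0| <= 1 + C * lyapunov p 0.
  have := hC (x k - p) l; have := ler_wpM2l C0 (sqnorm_le_lyapunov k).
  have := ler_wpM2l C0 (lyapunov_noninc (leq0n k)).
  rewrite -(real_normK (num_real ((x k - p) l 0))) => ? ? ?.
  have := sqr_ge0 `|(x k - p) l 0|.
  by have := sqr_ge0 (`|(x k - p) l 0| - 1); rewrite sqrrB1; lra.
have : `|p l 0| <= \sum_l `|p l 0| by rewrite (bigD1 l) //= lerDl sumr_ge0.
rewrite !mxE => ? ?; have := ler_normD (x k l 0 - p l 0) (p l 0).
by rewrite subrK; lra.
Qed.

Lemma lyapunov_small_cvg :
  (forall e : R, 0 < e -> exists k, lyapunov p k < e) -> x @ \oo --> p.
Proof.
move=> small; have [C C0 hC] := posdef_coord_bound hD.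
apply/cvg_ballP => e e0; have C1 : 0 < C + 1 by lra.
(* The divisor is [C + 1] because [C] may be 0. *)
have [k0 lk0] := small (e ^+ 2 / (C + 1)) (divr_gt0 (exprn_gt0 2 e0) C1).
exists k0 => // k /= k0k; split=> // i l; rewrite (ord1 l) {l}.
rewrite -ball_normE /= distrC.
have -> : x k i 0 - p i 0 = (x k - p) i 0 by rewrite !mxE.
rewrite -(@ltr_pXn2r _ 2) ?nnegrE // ?ltW // real_normK ?num_real //.
apply: le_lt_trans (hC _ _) _.
have le_k : sqnorm (x k - p) <= lyapunov p k0.
  exact: le_trans (sqnorm_le_lyapunov k) (lyapunov_noninc k0k).
apply: le_lt_trans (ler_wpM2l C0 le_k) _.
move: lk0; rewrite ltr_pdivlMr //.
have := le_trans (posdef_ge0 _ hD) le_k.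
lra.
Qed.

End Minimizer.

End SlinAnalysis.

Theorem theorem3p4 (R : realType) (n N : nat) (hN : (2 <= N)%N)
    (D : 'M[R]_n) (hD : sym_posdef D)
    (f : 'I_N -> 'cV[R]_n -> R) (hf : forall i, convex_fun (f i))
    (beta : R) (hbeta0 : 0 < beta) (hbeta1 : beta < 1)
    (x : nat -> 'cV[R]_n) (j : nat -> 'I_N) (z g : nat -> 'I_N -> 'cV[R]_n)
    (hrun : slin_run f x j z g D 0 beta)
    (hArgmin : Argmin (Ftot f) !=set0)
    (hK : infinite_set [set k | x k.+1 <> x k]) :
  exists2 xstar, Argmin (Ftot f) xstar & x @ \oo --> xstar.
Proof.
have [p hp] := hArgmin.
have Fcvg q (hq : Argmin (Ftot f) q) := Ftot_center_cvg hD hf hbeta0 hrun hq hK.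
have [M xM] := center_bounded hD hf hbeta0 hrun hp.
have [u clu] := bounded_seq_cluster xM.
have hu : Argmin (Ftot f) u.
  move=> y; apply: le_trans (hp y); apply/ler_addgt0Pr => e e0.
  have [C C0 hC] := convex_fun_lower_bound u (convex_fun_Ftot hf).
  have [k0 Fk0] := Fcvg p hp (e / 2) (divr_gt0 e0 (ltr0Sn R 1)).
  (* The radius [e / (2 * (C + 1))] makes the lower semicontinuity error at most [e / 2]; the other
     half is the excess of [F (x k)] over the minimum. *)
  have C1 : 0 < 2 * (C + 1) by lra.
  have d0 := divr_gt0 e0 C1.
  have [k /Fk0 Fk uk] := clu _ k0 d0.
  have := hC (x k) _ (ltW d0) (fun l => ltW (uk l)).
  have : C * (e / (2 * (C + 1))) <= e / 2.
    rewrite mulrA ler_pdivrMr // -subr_ge0.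
    by rewrite (_ : _ - _ = e) ?ltW //; field.
  lra.
exists u => //; apply: (lyapunov_small_cvg hD hf hbeta0 hrun hu) => e e0.
have [C C0 hC] := quadratic_coord_bound D.
(* After multiplication by [2 / beta] this tolerance contributes less than [e / 2]; the squared
   distance, for a cluster radius whose square is [e / (4 * (C + 1))], contributes at most
   [e / 4]. *)
have [k0 Fk0] := Fcvg u hu (beta * (e / 4)) (mulr_gt0 hbeta0 (divr_gt0 e0 (ltr0Sn R 3))).
have C1 : 0 < 4 * (C + 1) by lra.
have d0 := divr_gt0 e0 C1.
have s0 : 0 < Num.sqrt (e / (4 * (C + 1))) by rewrite sqrtr_gt0.
have [k /Fk0 Fk uk] := clu _ k0 s0.
exists k; rewrite /lyapunov.
have xuk l : `|(x k - u) l 0| <= Num.sqrt (e / (4 * (C + 1))).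
  by have := ltW (uk l); rewrite -opprB mxE normrN.
have := hC _ _ (sqrtr_ge0 _) xuk; rewrite sqr_sqrtr; last exact: ltW.
have : C * (e / (4 * (C + 1))) <= e / 4.
  rewrite mulrA ler_pdivrMr // -subr_ge0.
  by rewrite (_ : _ - _ = e) ?ltW //; field.
have : 2 / beta * (Ftot f (x k) - Ftot f u) < e / 2.
  rewrite (_ : e / 2 = 2 / beta * (beta * (e / 4))); last first.
    by field; rewrite gt_eqF.
  by rewrite ltr_pM2l ?divr_gt0 //; lra.
lra.
Qed.
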